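(* Let $F$ be a field of characteristic $0$, let $n\ge 0$, and let $(l^*_0,l^*_1,l^*_2,l^*_3)\in C_4(\mathbb{A}^2_{F[\varepsilon]_{n+1}})$ be four vectors in generic position, written $l^*_i=l_i+l_{i,\varepsilon}\varepsilon+l_{i,\varepsilon^2}\varepsilon^2+\cdots+l_{i,\varepsilon^n}\varepsilon^n$. Then, in $F[\varepsilon]_{n+1}$, $$\Delta(l^*_0,l^*_1)\,\Delta(l^*_2,l^*_3)=\Delta(l^*_0,l^*_2)\,\Delta(l^*_1,l^*_3)-\Delta(l^*_0,l^*_3)\,\Delta(l^*_1,l^*_2).$$
   Context: For $\nu\ge 1$, $F[\varepsilon]_\nu:=F[\varepsilon]/\varepsilon^\nu$ is the truncated polynomial ring. $C_m(\mathbb{A}^2_{F[\varepsilon]_{\nu}})$ is the free abelian group generated by configurations of $m$ vectors in the affine plane over $F[\varepsilon]_\nu$ in generic position. A vector is written $l^*_i=l_i+l_{i,\varepsilon}\varepsilon+\cdots+l_{i,\varepsilon^n}\varepsilon^n$ (with $\nu=n+1$), where $l_{i,\varepsilon^k}\in\mathbb{A}^2_F=F^2$ and $l_{i,\varepsilon^0}=l_i$. Generic position means $\Delta(l_i,l_j)\ne0$ for $i\neq j$. Here $\Delta(l_i,l_j)\in F$ denotes the $2\times 2$ determinant of $l_i,l_j\in F^2$ (the value of a fixed volume form on $l_i\wedge l_j$), and $$\Delta(l^*_i,l^*_j)=\Delta(l_i,l_j)+\Delta(l^*_i,l^*_j)_{\varepsilon}\,\varepsilon+\cdots+\Delta(l^*_i,l^*_j)_{\varepsilon^n}\,\varepsilon^n,$$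 where, for each $k$ with $0\le k\le n$, $\Delta(l^*_i,l^*_j)_{\varepsilon^k}=\Delta(l_i,l_{j,\varepsilon^k})+\Delta(l_{i,\varepsilon},l_{j,\varepsilon^{k-1}})+\cdots+\Delta(l_{i,\varepsilon^k},l_j)$. *)

(* Defs.v *)
From mathcomp Require Import all_boot all_order all_algebra.

Set Implicit Arguments.
Unset Strict Implicit.
Unset Printing Implicit Defensive.

Import GRing.Theory.
Local Open Scope ring_scope.

(* For nu >= 1 this is the genuine F[X]/(X^nu); for nu = 0 the library would
   silently replace the modulus by 'X, so only nu = n.+1 is used below. *)
Notation truncpoly F nu := {poly %/ ('X^nu : {poly F})}.

Section TruncatedVolume.

Variables (F : fieldType) (n : nat).

Local Notation Feps := (truncpoly F n.+1).

(* When n = 0 this is 0, as 'qX is the class of 'X modulo 'X^n.+1. *)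
Definition eps : Feps := 'qX.

(* The vector l_{i, eps^k} of F^2: an element of Feps coerces to its reduced
   representative in {poly F}, whose k-th coefficient is taken coordinatewise. *)
Definition vcoef (l : 'rV[Feps]_2) (k : nat) : 'rV[F]_2 :=
  map_mx (fun a : Feps => (a : {poly F})`_k) l.

Definition Delta (u v : 'rV[F]_2) : F := \det (col_mx u v).

Definition Delta_coef (l m : 'rV[Feps]_2) (k : nat) : F :=
  \sum_(i < k.+1) Delta (vcoef l i) (vcoef m (k - i)).

Definition Delta_star (l m : 'rV[Feps]_2) : Feps :=
  \sum_(k < n.+1) Delta_coef l m k *: eps ^+ k.

Definition generic_position (m : nat) (l : m.-tuple 'rV[Feps]_2) : Prop :=
  forall i j : 'I_m, i != j ->
    Delta (vcoef (tnth l i) 0) (vcoef (tnth l j) 0) != 0.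

End TruncatedVolume.

(* Main.v *)
(** Truncated power series multiply by the Cauchy product, so [Delta_star l m]
    is the 2x2 determinant of the coordinates of [l] and [m] in the commutative
    ring F[eps]/(eps^(n+1)), where the identity is the three-term Plücker relation. *)

Require Import Defs.
From mathcomp Require Import all_boot all_order all_algebra.
From mathcomp Require Import ring.

Import GRing.Theory.
Local Open Scope ring_scope.

Lemma det_mx22 (R : comNzRingType) (A : 'M[R]_2) :
  \det A = A 0 0 * A 1 1 - A 0 1 * A 1 0.
Proof.
rewrite (expand_det_row _ 0) !big_ord_recl big_ord0 addr0 /cofactor !det_mx11.
rewrite !mxE expr0 expr1 mul1r mulN1r mulrN.
(* The minors index [A] by [lift] ordinals, which match [0] and [1] only by value. *)
by congr (A _ _ * A _ _ - A _ _ * A _ _); apply: val_inj.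
Qed.

Lemma DeltaE (F : fieldType) (u v : 'rV[F]_2) :
  Delta u v = u 0 0 * v 0 1 - u 0 1 * v 0 0.
Proof.
have row0 j : col_mx u v (0 : 'I_2) j = u 0 j.
  by rewrite -(col_mxEu u v); congr (fun_of_matrix _ _ _); apply: val_inj.
have row1 j : col_mx u v (1 : 'I_2) j = v 0 j.
  by rewrite -(col_mxEd u v); congr (fun_of_matrix _ _ _); apply: val_inj.
by rewrite /Delta det_mx22 !row0 !row1.
Qed.

(** Split [p] at degree [n.+1]: the upper part is a multiple of ['X^(n.+1)] and dies in the
    quotient, while each ['X^k] of the lower part maps to [eps ^+ k]. *)
Lemma in_truncpolyE (F : fieldType) (n : nat) (p : {poly F}) :
  in_qpoly 'X^(n.+1) p = \sum_(k < n.+1) p`_k *: eps F n ^+ k.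
Proof.
have X0 : in_qpoly 'X^(n.+1) 'X^(n.+1) = 0 :> truncpoly F n.+1.
  (* The exponent is a successor, so [mk_monic] keeps ['X^(n.+1)] as the modulus. *)
  by apply: val_inj; rewrite /= mk_monic_Xn Pdiv.RingMonic.rmodpp ?monicXn.
rewrite -[p in LHS](poly_take_drop n.+1) in_qpolyD in_qpolyM X0 mulr0 addr0.
rewrite /take_poly poly_def raddf_sum; apply: eq_bigr => k _.
by rewrite /= in_qpolyZ rmorphXn.
Qed.

Lemma truncpolyM (F : fieldType) (n : nat) (a b : truncpoly F n.+1) :
  a * b = \sum_(k < n.+1)
    (\sum_(i < k.+1) (a : {poly F})`_i * (b : {poly F})`_(k - i)) *: eps F n ^+ k.
Proof.
(* By definition, the quotient multiplies representatives and then reduces. *)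
transitivity (in_qpoly 'X^(n.+1) ((a : {poly F}) * (b : {poly F}))); first by [].
by rewrite in_truncpolyE; apply: eq_bigr => k _; rewrite coefM.
Qed.

Lemma Delta_starE (F : fieldType) (n : nat) (l m : 'rV[truncpoly F n.+1]_2) :
  Delta_star l m = l 0 0 * m 0 1 - l 0 1 * m 0 0.
Proof.
(* Both sides are now sums over the powers of [eps], compared coefficient by coefficient. *)
rewrite !truncpolyM -sumrB; apply: eq_bigr => k _.
rewrite -scalerBl -sumrB; congr (_ *: _); apply: eq_bigr => i _.
by rewrite DeltaE !mxE.
Qed.

Theorem lemma2p1 (F : fieldType) (charF0 : [pchar F] =i pred0) (n : nat)
    (l0 l1 l2 l3 : 'rV[truncpoly F n.+1]_2)
    (generic_l : generic_position [tuple l0; l1; l2; l3]) :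
  Delta_star l0 l1 * Delta_star l2 l3 =
  Delta_star l0 l2 * Delta_star l1 l3 - Delta_star l0 l3 * Delta_star l1 l2.
Proof. rewrite !Delta_starE; ring. Qed.
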